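(* There exists an absolute constant $C>0$ such that the following holds. Let $M$ be a commutative Moufang loop of exponent $3$, let $K\ge1$, and let $A\subseteq M$ be a finite $K$-approximate subloop. Put $H=\langle A\rangle$ and let $d=d(H)$ be the minimal size of a generating set of $H$. Then there exists a finite subloop $J\le H$ such that: (i) $A$ is covered by at most $(2K\beta(d))^C$ left cosets of $J$; (ii) $|J|\le\beta(d)\,|A|$.
   Context: A loop is a set with a binary operation having a two-sided identity $1$ such that for all $a,b$ the equations $ax=b$ and $ya=b$ have unique solutions. A Moufang loop is a loop satisfying $(xy)(zx)=(x(yz))x$ for all $x,y,z$; it is commutative if $xy=yx$ for all $x,y$. Powers of an element in a Moufang loop are unambiguously defined; a loop of exponent $3$ satisfies $x^3=1$ for all $x$. For subsets $X,Y$ of a loop, $XY=\{xy:x\in X,y\in Y\}$. For a finite subset $A$ of a loop, $A^{\langle 3\rangle}:=(AA)A\cup A(AA)$. A finite subset $A$ of a loop is a $K$-approximate subloop if $1\in A$, $A=A^{-1}$ and $|A^{\langle 3\rangle}|\le K|A|$. $\langle A\rangle$ denotes the subloop generated by $A$. The associator $(x,y,z)$ in a loop is defined by $(xy)z=(x(yz))\,(x,y,z)$, and for a loop $F$, $F'=(F,F,F)$ denotes the subloop generated by all associators of elements of $F$. For $m\in\mathbb{N}$, $\beta(m):=|F_m'|$, where $F_m$ is the free commutative Moufang loop on $m$ generators; this is finite by the classical fact that finitely generated commutative Moufang loops have finite associator subloop. A left coset of $J$ is a set $xJ$ with $x\in H$. *)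

(* Defs.v *)
From HB Require Import structures.
From mathcomp Require Import all_boot all_order all_algebra.
From mathcomp Require Import finmap.
From mathcomp Require Import all_classical all_reals all_analysis.
Set Implicit Arguments.
Unset Strict Implicit.
Unset Printing Implicit Defensive.
Import Order.TTheory GRing.Theory Num.Theory.

Local Open Scope classical_set_scope.
Local Open Scope group_scope.

HB.mixin Record UMagma_isLoop L of UMagma L := {
  ex_ldiv : forall a b : L, exists! x, a * x = b;
  ex_rdiv : forall a b : L, exists! y, y * a = b
}.

#[short(type="loopType")]
HB.structure Definition Loop := {L of UMagma_isLoop L & UMagma L}.

(* [ldiv a b] is the solution of [a * x = b],
   [rdiv b a] the solution of [y * a = b]. *)
Definition ldiv (L : loopType) (a b : L) : L := sval (cid (ex_ldiv a b)).
Definition rdiv (L : loopType) (b a : L) : L := sval (cid (ex_rdiv a b)).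

Section LoopTheory.
Variable L : loopType.
Implicit Types a b x y : L.

Lemma mulKldiv a b : a * ldiv a b = b.
Proof. by rewrite /ldiv; case: cid => x []. Qed.

Lemma rdivKmul a b : rdiv b a * a = b.
Proof. by rewrite /rdiv; case: cid => x []. Qed.

Lemma loop_mulgI a : injective (fun x => a * x).
Proof.
by move=> x y /= axy; have [z [_ uz]] := ex_ldiv a (a * y);
  rewrite -(uz x axy) (uz y).
Qed.

Lemma loop_mulIg a : injective (fun x => x * a).
Proof.
by move=> x y /= xya; have [z [_ uz]] := ex_rdiv a (y * a);
  rewrite -(uz x xya) (uz y).
Qed.

Lemma ldivKmul a b : ldiv a (a * b) = b.
Proof. by apply: (@loop_mulgI a); rewrite mulKldiv. Qed.

Lemma mulKrdiv a b : rdiv (b * a) a = b.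
Proof. by apply: (@loop_mulIg a); rewrite rdivKmul. Qed.

End LoopTheory.

(* The right inverse; in a Moufang loop it is the two-sided inverse. *)
Definition loop_inv (L : loopType) (x : L) : L := ldiv x 1.

Definition moufang (L : loopType) : Prop :=
  forall x y z : L, (x * y) * (z * x) = (x * (y * z)) * x.

Definition is_cml (L : loopType) : Prop :=
  moufang L /\ (forall x y : L, x * y = y * x).

Definition exponent3 (L : loopType) : Prop := forall x : L, x ^+ 3 = 1.

Definition associator (L : loopType) (x y z : L) : L :=
  ldiv (x * (y * z)) ((x * y) * z).

Definition is_subloop (L : loopType) (S : set L) : Prop :=
  [/\ S 1,
      forall x y, S x -> S y -> S (x * y),
      forall a b, S a -> S b -> S (ldiv a b)
    & forall a b, S a -> S b -> S (rdiv b a)].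

Definition gen_subloop (L : loopType) (X : set L) : set L :=
  smallest (@is_subloop L) X.

Definition assoc_subloop (L : loopType) : set L :=
  gen_subloop [set a : L | exists x y z : L, a = associator x y z].
Arguments assoc_subloop : clear implicits.

Definition is_min_gen_size (L : loopType) (H : set L) (d : nat) : Prop :=
  (exists2 S : {fset L}, gen_subloop [set` S] = H & #|` S| = d) /\
  (forall S : {fset L}, gen_subloop [set` S] = H -> (d <= #|` S|)%N).

Definition fset_mulg (L : loopType) (X Y : {fset L}) : {fset L} :=
  [fset x * y | x in X, y in Y]%fset.

Definition fset_triple (L : loopType) (A : {fset L}) : {fset L} :=
  (fset_mulg (fset_mulg A A) A `|` fset_mulg A (fset_mulg A A))%fset.

Definition approx_subloop (R : realType) (L : loopType) (K : R)
    (A : {fset L}) : Prop :=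
  [/\ 1 \in A,
      A = [fset loop_inv x | x in A]%fset
    & (#|` fset_triple A|%:R <= K * #|` A|%:R)%R].

Definition lcoset_loop (L : loopType) (x : L) (J : {fset L}) : {fset L} :=
  [fset x * j | j in J]%fset.

Inductive loop_term (m : nat) : Type :=
| LVar of 'I_m
| LOne
| LMul of loop_term m & loop_term m
| LDiv of loop_term m & loop_term m.
Arguments LOne {m}.

HB.instance Definition _ m := gen_eqMixin (loop_term m).
HB.instance Definition _ m := gen_choiceMixin (loop_term m).

(* Derivable equality in the variety of commutative Moufang loops. By
   commutativity left division also serves as right division. *)
Inductive cml_eq (m : nat) : loop_term m -> loop_term m -> Prop :=
| cml_refl t : cml_eq t t
| cml_sym t u : cml_eq t u -> cml_eq u t
| cml_trans t u v : cml_eq t u -> cml_eq u v -> cml_eq t v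
| cml_congM t t' u u' :
    cml_eq t t' -> cml_eq u u' -> cml_eq (LMul t u) (LMul t' u')
| cml_congD t t' u u' :
    cml_eq t t' -> cml_eq u u' -> cml_eq (LDiv t u) (LDiv t' u')
| cml_mul1 t : cml_eq (LMul LOne t) t
| cml_mulC t u : cml_eq (LMul t u) (LMul u t)
| cml_mulD t u : cml_eq (LMul t (LDiv t u)) u
| cml_divM t u : cml_eq (LDiv t (LMul t u)) u
| cml_moufang t u v :
    cml_eq (LMul (LMul t u) (LMul v t)) (LMul (LMul t (LMul u v)) t).

Section FreeCML.
Variable m : nat.
Implicit Types t u v : loop_term m.
Local Open Scope quotient_scope.

Definition cml_eqb t u : bool := `[< cml_eq t u >].

Lemma cml_eqb_equiv : equiv_class_of cml_eqb.
Proof.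
split=> [t|t u|u t v].
- exact/asboolP/cml_refl.
- by apply/asboolP/asboolP; apply: cml_sym.
- by move=> /asboolP tu /asboolP uv; apply/asboolP; apply: cml_trans tu uv.
Qed.

Canonical cml_eqb_equivrel := EquivRelPack cml_eqb_equiv.

Definition free_cml : Type := {eq_quot cml_eqb}.
HB.instance Definition _ := Choice.on free_cml.
HB.instance Definition _ := Quotient.on free_cml.

Lemma free_cmlE t u : \pi_free_cml t = \pi_free_cml u <-> cml_eq t u.
Proof.
by split=> [/eqmodP/asboolP //|tu]; apply/eqmodP/asboolP.
Qed.

Lemma free_cml_repr t : cml_eq (repr (\pi_free_cml t)) t.
Proof. by apply/free_cmlE; rewrite reprK. Qed.

Definition free_one : free_cml := \pi_free_cml LOne.
Definition free_mul (x y : free_cml) : free_cml :=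
  \pi_free_cml (LMul (repr x) (repr y)).
Definition free_gen (i : 'I_m) : free_cml := \pi_free_cml (LVar i).

Lemma free_mulE t u :
  free_mul (\pi_free_cml t) (\pi_free_cml u) = \pi_free_cml (LMul t u).
Proof. by apply/free_cmlE; apply: cml_congM; apply: free_cml_repr. Qed.

Lemma free_mulC : commutative free_mul.
Proof. by move=> x y; apply/free_cmlE/cml_mulC. Qed.

Lemma free_mul1 : left_id free_one free_mul.
Proof.
elim/quotW=> t; rewrite free_mulE; exact/free_cmlE/cml_mul1.
Qed.

Lemma free_1mul : right_id free_one free_mul.
Proof. by move=> x; rewrite free_mulC free_mul1. Qed.

HB.instance Definition _ := hasMul.Build free_cml free_mul.
HB.instance Definition _ := Magma_isUMagma.Build free_cml free_mul1 free_1mul.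

Lemma free_mulgE t u :
  \pi_free_cml t * \pi_free_cml u = \pi_free_cml (LMul t u).
Proof. exact: free_mulE. Qed.

Lemma free_ex_ldiv (a b : free_cml) : exists! x, a * x = b.
Proof.
elim/quotW: a => t; elim/quotW: b => u; exists (\pi_free_cml (LDiv t u)); split.
  by rewrite free_mulgE; apply/free_cmlE/cml_mulD.
elim/quotW=> v; rewrite free_mulgE => /free_cmlE tvu; apply/free_cmlE.
apply: cml_trans (cml_divM t v); apply: cml_congD; first exact: cml_refl.
exact: cml_sym.
Qed.

Lemma free_ex_rdiv (a b : free_cml) : exists! y, y * a = b.
Proof.
have [x [ax ux]] := free_ex_ldiv a b; exists x; split.
  by rewrite [LHS]free_mulC.
by move=> y ya; apply: ux; rewrite [LHS]free_mulC.
Qed.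

HB.instance Definition _ :=
  UMagma_isLoop.Build free_cml free_ex_ldiv free_ex_rdiv.

Lemma free_cml_is_cml : is_cml free_cml.
Proof.
split; last exact: free_mulC.
elim/quotW=> t; elim/quotW=> u; elim/quotW=> v.
rewrite (free_mulgE t u) (free_mulgE v t) (free_mulgE u v).
rewrite (free_mulgE t (LMul u v)) (free_mulgE (LMul t u)) (free_mulgE _ t).
by apply/free_cmlE; apply: cml_moufang.
Qed.

Fixpoint loop_eval (L : loopType) (f : 'I_m -> L) (t : loop_term m) : L :=
  match t with
  | LVar i => f i
  | LOne => 1
  | LMul t u => loop_eval f t * loop_eval f u
  | LDiv t u => ldiv (loop_eval f t) (loop_eval f u)
  end.

Lemma loop_eval_eq (L : loopType) (f : 'I_m -> L) t u :
  is_cml L -> cml_eq t u -> loop_eval f t = loop_eval f u.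
Proof.
move=> [mouL comL]; elim=> //=.
- by move=> ? ? ? _ -> _ ->.
- by move=> ? ? ? ? _ -> _ ->.
- by move=> ? ? ? ? _ -> _ ->.
- by move=> ?; rewrite mul1g.
- by move=> ? ?; rewrite mulKldiv.
- by move=> ? ?; rewrite ldivKmul.
Qed.

Theorem free_cml_universal (L : loopType) (f : 'I_m -> L) : is_cml L ->
  exists! h : free_cml -> L,
    [/\ h 1 = 1, (forall x y, h (x * y) = h x * h y)
      & forall i, h (free_gen i) = f i].
Proof.
move=> cmlL; pose h (x : free_cml) := loop_eval f (repr x).
have hE t : h (\pi_free_cml t) = loop_eval f t.
  exact/loop_eval_eq/free_cml_repr.
exists h; split.
  split=> [|x y|i]; [exact: hE| |exact: hE].
  by elim/quotW: x => t; elim/quotW: y => u; rewrite free_mulgE !hE.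
move=> g [g1 gM gi]; apply/funext; elim/quotW=> t; rewrite hE.
elim: t => [i||t IHt u IHu|t IHt u IHu] /=.
- by rewrite -gi.
- by rewrite -[LHS]g1.
- by rewrite IHt IHu -[LHS]gM free_mulgE.
- rewrite IHt IHu; apply: (@loop_mulgI _ (g (\pi_free_cml t))) => /=.
  rewrite mulKldiv -[RHS]gM free_mulgE; congr g.
  by apply/esym/free_cmlE/cml_mulD.
Qed.

End FreeCML.

(* [counting] is the cardinality with values in [0, +oo], so no junk value is
   attached to F_m' and its finiteness (the Bruck-Slaby theorem) is not needed
   to state a bound in terms of [beta]. *)
Definition beta (R : realType) (m : nat) : \bar R :=
  counting (assoc_subloop (free_cml m)).

(* Main.v *)
(* Take for J the associator subloop H' of H. The quotient H/H' is an abelian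
   group of exponent 3 with d generators, so H' has at most 3^d cosets in H;
   and H' is contained in the image of F_d', so |J| <= beta(d). Finally beta(d)
   is at least 3^(d-2), because F_d maps onto a commutative Moufang loop of
   exponent 3 in which the associators (x_1, x_2, x_i), i > 2, are independent
   central elements; hence the number 3^d of cosets is bounded by a power of
   2 beta(d). The case beta(d) = +oo, where everything is trivially bounded, is
   treated apart, so the finiteness theorem of Bruck and Slaby is not needed. *)
Require Import Defs.
From HB Require Import structures.
From mathcomp Require Import all_boot all_order all_algebra.
From mathcomp Require Import finmap.
From mathcomp Require Import all_classical all_reals all_analysis.
From mathcomp Require Import ring.
Set Implicit Arguments.
Unset Strict Implicit.
Unset Printing Implicit Defensive.
Import Order.TTheory GRing.Theory Num.Theory.

Local Open Scope classical_set_scope.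
Local Open Scope group_scope.

(** * Subloops and associators under multiplicative maps *)

Section SubloopTheory.
Variables (L L' : loopType).

Lemma gen_subloop_is_subloop (X : set L) : is_subloop (gen_subloop X).
Proof.
split=> [T [[]]//|x y Sx Sy T TX|a b Sa Sb T TX|a b Sa Sb T TX];
  have [[T1 TM TD TR] _] := TX.
- by apply: TM; [apply: Sx|apply: Sy].
- by apply: TD; [apply: Sa|apply: Sb].
- by apply: TR; [apply: Sa|apply: Sb].
Qed.

Lemma assoc_subloop_is_subloop : is_subloop (assoc_subloop L).
Proof. exact: gen_subloop_is_subloop. Qed.

Lemma subloop_associator (S : set L) x y z :
  is_subloop S -> S x -> S y -> S z -> S (associator x y z).
Proof. by case=> _ SM SD _ Sx Sy Sz; apply: (SD); do ?apply: (SM). Qed.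

Variable h : L -> L'.
Hypothesis hM : {morph h : x y / x * y}.

Lemma morph_one : h 1 = 1.
Proof. by apply: (@loop_mulgI _ (h 1)); rewrite -hM !mulg1. Qed.

Lemma morph_ldiv a b : h (ldiv a b) = ldiv (h a) (h b).
Proof. by apply: (@loop_mulgI _ (h a)); rewrite -hM !mulKldiv. Qed.

Lemma morph_rdiv a b : h (rdiv b a) = rdiv (h b) (h a).
Proof. by apply: (@loop_mulIg _ (h a)); rewrite -hM !rdivKmul. Qed.

Lemma morph_associator x y z :
  h (associator x y z) = associator (h x) (h y) (h z).
Proof. by rewrite morph_ldiv !hM. Qed.

Lemma image_subloop (S : set L) : is_subloop S -> is_subloop (h @` S).
Proof.
case=> S1 SM SD SR; split.
- by exists 1 => //; rewrite morph_one.
- by move=> _ _ [x Sx <-] [y Sy <-]; exists (x * y); rewrite ?hM//; apply: SM.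
- move=> _ _ [x Sx <-] [y Sy <-]; exists (ldiv x y); rewrite ?morph_ldiv//.
  exact: SD.
- move=> _ _ [x Sx <-] [y Sy <-]; exists (rdiv y x); rewrite ?morph_rdiv//.
  exact: SR.
Qed.

Lemma preimage_subloop (S : set L') : is_subloop S -> is_subloop (h @^-1` S).
Proof.
case=> S1 SM SD SR; split=> [|x y|a b|a b]; rewrite /preimage/=.
- by rewrite morph_one.
- by rewrite hM; apply: SM.
- by rewrite morph_ldiv; apply: SD.
- by rewrite morph_rdiv; apply: SR.
Qed.

End SubloopTheory.

(** This is $H'$ computed inside the ambient loop, so that [H] can remain a set rather than a loop
    type. *)
Definition derived_subloop (L : loopType) (H : set L) : set L :=
  gen_subloop [set a | exists x y z, [/\ H x, H y, H z & a = associator x y z]].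

Lemma derived_subloop_sub (L : loopType) (H : set L) :
  is_subloop H -> derived_subloop H `<=` H.
Proof.
by move=> sH; apply: smallest_sub => // _ [x [y [z [? ? ? ->]]]];
  apply: subloop_associator.
Qed.

(** Arguments in [H] lift along [h], so each generating associator is the image of one; this turns
    finiteness and size of $F_d'$ into those of $H'$. *)
Lemma derived_subloop_image (L L' : loopType) (h : L -> L') (H : set L') :
  {morph h : x y / x * y} -> H `<=` range h ->
  derived_subloop H `<=` h @` assoc_subloop L.
Proof.
move=> hM Hh; apply: smallest_sub.
  by apply: image_subloop => //; apply: assoc_subloop_is_subloop.
move=> _ [_ [_ [_ [/Hh[x _ <-] /Hh[y _ <-] /Hh[z _ <-] ->]]]].
exists (associator x y z); last exact: morph_associator.
by apply: sub_gen_smallest; exists x, y, z.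
Qed.

(** * Identities and inner mappings in exponent 3 *)

Section Exponent3.
Variable L : loopType.
Hypotheses (cmlL : is_cml L) (exp3 : exponent3 L).
Implicit Types x y z u v : L.

Let mulC x y : x * y = y * x. Proof. by case: cmlL => _ ->. Qed.

Lemma cube_mul x : x * (x * x) = 1. Proof. exact: exp3. Qed.

(** The inverse property: when [u * v = 1], the Moufang identity reads $uy = (u(yv))u$, and [u]
    cancels on the right. Here $x^2$ is the inverse of $x$. *)
Lemma sqr_mulK x y : x * x * (x * y) = y.
Proof.
have inv_cancel u v : u * v = 1 -> u * (v * y) = y.
  move=> uv; apply: (@loop_mulIg _ u); have [/(_ u y v)] := cmlL.
  by rewrite [v * u]mulC uv mulg1 => E _; rewrite [y * u]mulC E [v * y]mulC.
by apply: inv_cancel; rewrite mulC cube_mul.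
Qed.

Lemma mul_mulA x y : x * (x * y) = x * x * y.
Proof.
have E : x * (x * (x * y)) = y.
  have [/(_ x x y)] := cmlL.
  by rewrite [y * x]mulC sqr_mulK mulC => E _.
by rewrite -{2}E sqr_mulK.
Qed.

Lemma mul_mul x y z : (x * y) * (x * z) = x * x * (y * z).
Proof.
have [/(_ x y z)] := cmlL.
by rewrite [z * x]mulC => -> _; rewrite mulC mul_mulA.
Qed.

Lemma sqr_sqr x : (x * x) * (x * x) = x.
Proof. exact: sqr_mulK. Qed.

Lemma ldivE x y : ldiv x y = x * x * y.
Proof. by rewrite -{2}(mulKldiv x y) sqr_mulK. Qed.

Lemma rdivE x y : rdiv y x = x * x * y.
Proof. by rewrite -{2}(rdivKmul x y) [rdiv y x * x]mulC sqr_mulK. Qed.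

Lemma mulKsqr x y : x * (x * x * y) = y.
Proof. by rewrite -ldivE mulKldiv. Qed.

Lemma mul_closed_subloop (S : set L) :
  S 1 -> (forall x y, S x -> S y -> S (x * y)) -> is_subloop S.
Proof.
move=> S1 SM; split=> // x y Sx Sy; [rewrite ldivE|rewrite rdivE];
  by do ?apply: (SM).
Qed.

(* In exponent 3 the operation (y z)^-1 = (y z)(y z) makes L a distributive
   quasigroup, of which every left translation is an automorphism; compositions
   of translations that fix 1 are therefore automorphisms of the loop. *)
Lemma translation_sqr x y z :
  x * ((y * z) * (y * z)) = ((x * y) * (x * z)) * ((x * y) * (x * z)).
Proof.
by rewrite (mul_mul x y z) (mul_mul (x * x) (y * z)) sqr_sqr.
Qed.

(** With $L_a$ the translation by $a$, this is $L_{xy}^{-1}L_xL_y$, because translation by $a^2$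
    inverts $L_a$. It measures the failure of associativity. *)
Definition inner_map x y z := (x * y) * (x * y) * (x * (y * z)).

Lemma mul_inner_map x y z : x * (y * z) = (x * y) * inner_map x y z.
Proof. by rewrite /inner_map mulKsqr. Qed.

Lemma inner_map1 x y : inner_map x y 1 = 1.
Proof. by rewrite /inner_map mulg1 mulC cube_mul. Qed.

(** The inverse mapping $L_y^{-1}L_x^{-1}L_{xy}$. *)
Definition inner_map_inv x y z := y * y * (x * x * ((x * y) * z)).

Lemma mul_inner_map_inv x y z : (x * y) * z = x * (y * inner_map_inv x y z).
Proof. by rewrite /inner_map_inv !mulKsqr. Qed.

Lemma inner_map_inv1 x y : inner_map_inv x y 1 = 1.
Proof. by rewrite /inner_map_inv mulg1 sqr_mulK mulC cube_mul. Qed.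

(** Setting $z = 1$ shows that [T] commutes with squaring; since squaring is an involution, the
    product is recovered from $(yz)^2$. *)
Lemma sqr_morph_mul (T : L -> L) : T 1 = 1 ->
  (forall y z, T ((y * z) * (y * z)) = (T y * T z) * (T y * T z)) ->
  {morph T : y z / y * z}.
Proof.
move=> T1 TS; have Tsqr y : T (y * y) = T y * T y.
  by have := TS y 1; rewrite T1 !mulg1.
by move=> y z /=; rewrite -[y * z]sqr_sqr Tsqr TS sqr_sqr.
Qed.

Lemma inner_mapM x y : {morph inner_map x y : u v / u * v}.
Proof.
by apply: sqr_morph_mul => [|u v]; [apply: inner_map1|
  rewrite /inner_map !translation_sqr].
Qed.

Lemma inner_map_invM x y : {morph inner_map_inv x y : u v / u * v}.
Proof.
by apply: sqr_morph_mul => [|u v]; [apply: inner_map_inv1|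
  rewrite /inner_map_inv !translation_sqr].
Qed.

(** * Cosets of the associator subloop and their representatives *)

Section Derived.
Variable H : set L.
Hypothesis sH : is_subloop H.
Local Notation J := (derived_subloop H).

Let HM x y : H x -> H y -> H (x * y). Proof. by case: sH => _ + _ _; apply. Qed.
Let JH : J `<=` H. Proof. exact: derived_subloop_sub. Qed.
Let sJ : is_subloop J. Proof. exact: gen_subloop_is_subloop. Qed.
Let J1 : J 1. Proof. by case: sJ. Qed.
Let JM x y : J x -> J y -> J (x * y). Proof. by case: sJ => _ + _ _; apply. Qed.

Lemma derived_subloop_stable (T : L -> L) : {morph T : y z / y * z} ->
  (forall y, H y -> H (T y)) -> forall y, J y -> J (T y).
Proof.
move=> TM TH; apply: (@smallest_sub _ _ _ (T @^-1` J)).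
  exact: preimage_subloop.
move=> _ [x [y [z [Hx Hy Hz ->]]]]; apply: sub_gen_smallest.
exists (T x), (T y), (T z); split; try exact: TH.
exact: morph_associator.
Qed.

Lemma derived_inner_map x y z : H x -> H y -> J z -> J (inner_map x y z).
Proof.
move=> Hx Hy; apply: derived_subloop_stable; first exact: inner_mapM.
by move=> u Hu; rewrite /inner_map; do ?apply: (HM).
Qed.

Lemma derived_inner_map_inv x y z :
  H x -> H y -> J z -> J (inner_map_inv x y z).
Proof.
move=> Hx Hy; apply: derived_subloop_stable; first exact: inner_map_invM.
by move=> u Hu; rewrite /inner_map_inv; do ?apply: (HM).
Qed.

(** Without associativity this is not visibly an equivalence; on [H] it becomes one because inner
    mappings by elements of [H] preserve [J]. *)
Definition same_coset x y : Prop := exists2 j, J j & y = x * j.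
Local Notation "x ~~ y" := (same_coset x y) (at level 70).

Lemma same_coset_refl x : x ~~ x.
Proof. by exists 1; rewrite ?mulg1. Qed.

Lemma same_coset_trans x y z : H x -> x ~~ y -> y ~~ z -> x ~~ z.
Proof.
move=> Hx [j Jj ->] [k Jk ->]; rewrite mul_inner_map_inv.
by exists (j * inner_map_inv x j k) => //; apply: JM => //;
  apply: derived_inner_map_inv => //; apply: JH.
Qed.

Lemma same_coset_sym x y : H x -> x ~~ y -> y ~~ x.
Proof.
move=> Hx [j Jj ->]; have Hj := JH Jj.
(* The inverse $j^2$ of $j$, corrected by the inner mapping that rebrackets $x(j j^2) = x$. *)
exists (inner_map x j (j * j)).
  by apply: derived_inner_map => //; apply: JM.
by rewrite -mul_inner_map cube_mul mulg1.
Qed.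

Lemma same_cosetMl x y z : H x -> H y -> y ~~ z -> x * y ~~ x * z.
Proof.
move=> Hx Hy [j Jj ->]; rewrite mul_inner_map.
by exists (inner_map x y j) => //; apply: derived_inner_map.
Qed.

Lemma same_cosetA x y z : H x -> H y -> H z -> x * (y * z) ~~ (x * y) * z.
Proof.
move=> Hx Hy Hz; exists (associator x y z); last by rewrite mulKldiv.
by apply: sub_gen_smallest; exists x, y, z.
Qed.

Lemma same_coset_in x y : H x -> x ~~ y -> H y.
Proof. by move=> Hx [j Jj ->]; apply: HM => //; apply: JH. Qed.

Lemma same_cosetM x x' y y' :
  H x -> H y -> x ~~ x' -> y ~~ y' -> x * y ~~ x' * y'.
Proof.
move=> Hx Hy xx' yy'; have Hx' := same_coset_in Hx xx'.
apply: (@same_coset_trans _ (x * y')); first exact: HM.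
  exact: same_cosetMl.
rewrite ![_ * y']mulC; apply: same_cosetMl => //.
exact: same_coset_in yy'.
Qed.

(** Modulo [J] the product is associative and commutative, so the middle factors can be
    exchanged. *)
Lemma same_cosetACA x y z t : H x -> H y -> H z -> H t ->
  (x * y) * (z * t) ~~ (x * z) * (y * t).
Proof.
move=> Hx Hy Hz Ht.
have Hyz := HM Hy Hz; have Hyt := HM Hy Ht; have Hzt := HM Hz Ht.
have swap a b c : H a -> H b -> H c -> a * (b * c) ~~ b * (a * c).
  move=> Ha Hb Hc; apply: (@same_coset_trans _ (a * b * c)).
  - by do ?apply: HM.
  - exact: same_cosetA.
  - rewrite [a * b]mulC; apply: same_coset_sym; first by do ?apply: HM.
    exact: same_cosetA.
apply: (@same_coset_trans _ (x * (y * (z * t)))); first by do ?apply: HM.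
  by apply: same_coset_sym; [do ?apply: HM|apply: same_cosetA].
apply: (@same_coset_trans _ (x * (z * (y * t)))); first by do ?apply: HM.
  by apply: same_cosetMl => //; [exact: HM|exact: swap].
exact: same_cosetA.
Qed.

(** Right-nested monomials with exponents 0, 1, 2, listed with possible repetitions: normal forms
    for an abelian group of exponent 3. *)
Fixpoint coset_reps (s : seq L) : seq L :=
  if s is a :: s' then
    [seq e * w | e <- [:: 1; a; a * a], w <- coset_reps s']
  else [:: 1].

Lemma size_coset_reps s : size (coset_reps s) = (3 ^ size s)%N.
Proof. by elim: s => // a s IHs; rewrite [LHS]size_allpairs IHs expnS. Qed.

Lemma coset_repsP a s x :
  reflect (exists p : L * L,
    [/\ p.1 \in [:: 1; a; a * a], p.2 \in coset_reps s & x = p.1 * p.2])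
  (x \in coset_reps (a :: s)).
Proof. exact: (@allpairsP _ _ _ (fun e w => e * w)). Qed.

Lemma coset_reps_sub s : [set` s] `<=` H -> [set` coset_reps s] `<=` H.
Proof.
elim: s => [_ x|a s IHs sub x]; first by rewrite /= inE => /eqP->; case: sH.
have Ha : H a by apply: sub; rewrite /= mem_head.
have {}IHs := IHs (fun y ys => sub y (@mem_behead _ (a :: s) y ys)).
move=> /coset_repsP[[e w] /= [ein win ->]]; apply: HM; last exact: IHs.
move: ein; rewrite !inE => /or3P[] /eqP->; [by case: sH|by []|exact: HM].
Qed.

Lemma pow3_closed (a e f : L) : e \in [:: 1; a; a * a] -> f \in [:: 1; a; a * a] ->
  e * f \in [:: 1; a; a * a].
Proof.
have aaa : a * a * a = 1 by rewrite mulC cube_mul.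
rewrite !inE => /or3P[] /eqP-> /or3P[] /eqP->;
  by rewrite ?mulg1 ?mul1g ?cube_mul ?aaa ?sqr_sqr ?eqxx ?orbT.
Qed.

(** Modulo [J], $(eu)(fv)$ becomes $(ef)(uv)$: exponents of the head add modulo 3 and induction
    handles the tails. *)
Lemma coset_repsM s (x y : L) : [set` s] `<=` H ->
  x \in coset_reps s -> y \in coset_reps s ->
  exists2 w, w \in coset_reps s & w ~~ x * y.
Proof.
elim: s x y => [|a s IHs] x y sub.
  rewrite !inE => /eqP-> /eqP->; exists 1; rewrite ?inE// mulg1.
  exact: same_coset_refl.
have sub' : [set` s] `<=` H.
  by move=> z zs; apply: sub; apply: (@mem_behead _ (a :: s)).
move=> /coset_repsP[[e u] /= [ein uin ->]] /coset_repsP[[f v] /= [fin vin ->]].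
have [w win wuv] := IHs _ _ sub' uin vin.
have Hrep := coset_reps_sub sub'.
have Ha : H a by apply: sub; rewrite /= mem_head.
have Hpow g : g \in [:: 1; a; a * a] -> H g.
  by rewrite !inE => /or3P[] /eqP->; [case: sH|by []|exact: HM].
exists ((e * f) * w).
  by apply/coset_repsP; exists (e * f, w); split=> //; exact: pow3_closed.
have [He Hf] := (Hpow _ ein, Hpow _ fin).
have [[Hu Hv] Hw] := (Hrep _ uin, Hrep _ vin, Hrep _ win).
apply: (@same_coset_trans _ ((e * f) * (u * v))).
- by do ?apply: HM.
- by apply: same_cosetMl => //; do ?apply: HM.
- exact: same_cosetACA.
Qed.

(** The elements whose coset has a listed representative are closed under products, hence form a
    subloop by exponent 3, and they include [s]. *)
Lemma derived_subloop_cover s : [set` s] `<=` H ->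
  gen_subloop [set` s] `<=`
    [set x | exists2 w, w \in coset_reps s & w ~~ x].
Proof.
move=> sub; have Hrep := coset_reps_sub sub.
have one_rep t : 1 \in coset_reps t.
  elim: t => [|a t IHt]; rewrite ?inE//.
  by apply/coset_repsP; exists (1, 1); rewrite mulg1 IHt inE eqxx.
apply: smallest_sub.
  apply: mul_closed_subloop.
    by exists 1 => //; apply: same_coset_refl.
  move=> x y [u uin ux] [v vin vy]; have [w win wuv] := coset_repsM sub uin vin.
  exists w => //; apply: same_coset_trans wuv _; first exact: Hrep.
  by apply: same_cosetM => //; apply: Hrep.
move=> x /= xs; exists x; last exact: same_coset_refl.
elim: s xs {sub Hrep} => // a s IHs; rewrite inE => /predU1P[->|xs].
  apply/coset_repsP; exists (a, 1).
  by rewrite mulg1 one_rep !inE eqxx orbT.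
by apply/coset_repsP; exists (1, x); rewrite mul1g IHs// inE eqxx.
Qed.
End Derived.
End Exponent3.

(* An explicit loop bounding the free associator subloop from below *)
Local Close Scope group_scope.
Local Open Scope ring_scope.

(* Zassenhaus' loop of order 81 (the case n = 1), with n copies of the last two
   coordinates. *)
Record cml3 n := Cml3 {
  cml3_fst : 'F_3; cml3_snd : 'F_3; cml3_vec : 'rV['F_3]_n;
  cml3_ctr : 'rV['F_3]_n }.

Section Cml3.
Variable n : nat.
Implicit Types x y z : cml3 n.

HB.instance Definition _ := gen_eqMixin (cml3 n).
HB.instance Definition _ := gen_choiceMixin (cml3 n).

Definition cml3_one : cml3 n := Cml3 0 0 0 0.

(** A determinant times a difference: both factors change sign when [x] and [y] are swapped, which
    gives commutativity. *)
Definition cml3_cocycle x y : 'rV['F_3]_n :=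
  (cml3_fst x * cml3_snd y - cml3_snd x * cml3_fst y)
    *: (cml3_vec x - cml3_vec y).

Definition cml3_mul x y : cml3 n :=
  Cml3 (cml3_fst x + cml3_fst y) (cml3_snd x + cml3_snd y)
    (cml3_vec x + cml3_vec y)
    (cml3_ctr x + cml3_ctr y + cml3_cocycle x y).

Lemma cml3_mulC : commutative cml3_mul.
Proof.
move=> [p q v t] [p' q' v' t']; rewrite /cml3_mul /cml3_cocycle /=.
by congr Cml3; try exact: addrC; apply/rowP => i; rewrite !mxE; ring.
Qed.

Lemma cml3_mul1 : left_id cml3_one cml3_mul.
Proof.
move=> [p q v t]; rewrite /cml3_mul /cml3_cocycle /=.
by rewrite !add0r !mul0r subr0 scale0r addr0.
Qed.

Lemma cml3_1mul : right_id cml3_one cml3_mul.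
Proof. by move=> x; rewrite cml3_mulC cml3_mul1. Qed.

HB.instance Definition _ := hasMul.Build (cml3 n) cml3_mul.
HB.instance Definition _ :=
  Magma_isUMagma.Build (cml3 n) cml3_mul1 cml3_1mul.

Lemma cml3_ex_ldiv (a b : cml3 n) : exists! x, (a * x)%g = b.
Proof.
case: a b => [p q v t] [p' q' v' t'].
exists (Cml3 (p' - p) (q' - q) (v' - v)
  (t' - t - (p * (q' - q) - q * (p' - p)) *: (v - (v' - v)))); split.
  congr Cml3; rewrite /cml3_cocycle /=; [ring|ring| |];
    by apply/rowP => i; rewrite !mxE; ring.
move=> [p2 q2 v2 t2] [<- <- <- <-]; rewrite /cml3_cocycle /=.
by congr Cml3; [ring|ring| |]; apply/rowP => i; rewrite !mxE; ring.
Qed.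

Lemma cml3_ex_rdiv (a b : cml3 n) : exists! y, (y * a)%g = b.
Proof.
have [x [ax ux]] := cml3_ex_ldiv a b; exists x; split.
  by rewrite [LHS]cml3_mulC.
by move=> y ya; apply: ux; rewrite [LHS]cml3_mulC.
Qed.

HB.instance Definition _ :=
  UMagma_isLoop.Build (cml3 n) cml3_ex_ldiv cml3_ex_rdiv.

Lemma cml3_is_cml : is_cml (cml3 n).
Proof.
split; last exact: cml3_mulC.
have three0 : (1 + 1 + 1 : 'F_3) = 0 by apply/val_inj.
move=> [p q v t] [p' q' v' t'] [p2 q2 v2 t2].
congr Cml3; do 3!rewrite /cml3_cocycle /=; [ring|ring| |].
  by apply/rowP => i; rewrite !mxE; ring.
apply/rowP => i; rewrite !mxE; apply/eqP; rewrite -subr_eq0; apply/eqP.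
(* The two sides of the Moufang identity differ by 3 times a polynomial, which vanishes only by
   characteristic 3; [ring] alone cannot see this. *)
transitivity ((1 + 1 + 1) * ((p * q' - q * p') * v2 0 i
  + (p * q2 - q * p2) * v' 0 i)); first by ring.
by rewrite three0 mul0r.
Qed.

Definition cml3_gen (i : 'I_(2 + n)) : cml3 n :=
  match fintype.split i with
  | inl j => if val j == 0%N then Cml3 1 0 0 0 else Cml3 0 1 0 0
  | inr j => Cml3 0 0 (delta_mx 0 j) 0
  end.

End Cml3.
Arguments cml3 : clear implicits.

Lemma cml3_ctr_sub n (S : set (cml3 n)) : is_subloop S ->
  (forall j, S (Cml3 0 0 0 (delta_mx 0 j))) -> forall t, S (Cml3 0 0 0 t).
Proof.
move=> [S1 SM _ _] Sdelta t.
have SD u v : S (Cml3 0 0 0 u) -> S (Cml3 0 0 0 v) -> S (Cml3 0 0 0 (u + v)).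
  move=> Su Sv; have := SM _ _ Su Sv; congr S; congr Cml3 => /=; rewrite ?addr0//.
  by rewrite /cml3_cocycle /= mul0r subrr scale0r addr0.
rewrite (row_sum_delta t); elim/big_ind: _ => // j _.
(* A scalar of ['F_3] acts as a natural multiple, so closure under addition suffices. *)
rewrite -[t 0 j]natr_Zp scaler_nat; elim: (nat_of_ord _) => [|k IHk].
  by rewrite mulr0n.
by rewrite mulrS; apply: SD.
Qed.

(** One bracketing has central coordinate [- e], the other 0; the associator makes up the
    difference. *)
Lemma cml3_gen_associator n (j : 'I_n) :
  associator (cml3_gen (lshift n (0 : 'I_2)))
    (cml3_gen (lshift n (1 : 'I_2)))
    (cml3_gen (rshift 2 j)) = Cml3 0 0 0 (delta_mx 0 j).
Proof.
rewrite -[lshift n 0]/(unsplit (inl 0)) -[lshift n 1]/(unsplit (inl 1)).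
rewrite -[rshift 2 j]/(unsplit (inr j)) /cml3_gen !unsplitK /=.
set e := delta_mx 0 j; set x := Cml3 1 0 0 0; set y := Cml3 0 1 0 0.
set z := Cml3 0 0 e 0.
have Exy : (x * (y * z))%g = Cml3 1 1 e (- e).
  congr Cml3; do 2!rewrite /cml3_cocycle /=; [ring|ring| |];
    by apply/rowP => i; rewrite !mxE; ring.
apply: (@loop_mulgI _ (x * (y * z))%g); rewrite /= mulKldiv Exy.
congr Cml3; do 2!rewrite /cml3_cocycle /=; [ring|ring| |];
  by apply/rowP => i; rewrite !mxE; ring.
Qed.

(** By universality the free loop maps to [cml3 n], and the image of its associator subloop contains
    all $3^n$ elements with only a central coordinate. *)
Lemma card_assoc_subloop_free n :
  finite_set (assoc_subloop (free_cml (2 + n))) ->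
  (3 ^ n <= #|` fset_set (assoc_subloop (free_cml (2 + n)))|)%N.
Proof.
move=> fin; have [h [[_ hM hgen] _]] :=
  free_cml_universal (@cml3_gen n) (cml3_is_cml n).
have sub : forall t, (h @` assoc_subloop (free_cml (2 + n))) (Cml3 0 0 0 t).
  apply: cml3_ctr_sub => [|j].
    by apply: image_subloop => //; apply: assoc_subloop_is_subloop.
  rewrite -cml3_gen_associator -!hgen -morph_associator//.
  by eexists; [apply: sub_gen_smallest; do 3!eexists|].
have : ([fset (Cml3 0 0 0 t : cml3 n) | t in 'rV['F_3]_n]
    `<=` h @` fset_set (assoc_subloop (free_cml (2 + n))))%fset.
  apply/fsubsetP => _ /imfsetP[t _ ->]; apply/imfsetP.
  by have [x xin <-] := sub t; exists x => //=; rewrite in_fset_set// inE.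
move=> /fsubset_leq_card/leq_trans/(_ (leq_imfset_card _ _ _)).
rewrite card_imfset/=; last by move=> u v [].
by rewrite -cardE card_mx card_Fp// mul1n.
Qed.

Lemma exp3_leq_card_assoc_subloop_free d :
  finite_set (assoc_subloop (free_cml d)) ->
  (3 ^ d <= 9 * #|` fset_set (assoc_subloop (free_cml d))|)%N.
Proof.
have one m : assoc_subloop (free_cml m) 1%g.
  by have [] := assoc_subloop_is_subloop (free_cml m).
case: d => [|[|n]] fin; last first.
- by rewrite -[n.+2]/(2 + n)%N expnD leq_mul2l card_assoc_subloop_free.
(* For $d < 2$ it is enough that $3^d \le 9$ and that the associator subloop contains 1. *)
all: apply: (@leq_trans (9 * 1)) => //; rewrite leq_mul2l/= cardfs_gt0.
all: apply/fset0Pn; exists 1%g; rewrite in_fset_set// inE.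
all: exact: one.
Qed.

(** * Transfer from the free loop, and the two bounds *)

Lemma gen_subloop_range_free (L : loopType) (S : {fset L}) : is_cml L ->
  exists2 h : free_cml #|` S| -> L, {morph h : x y / (x * y)%g} &
    gen_subloop [set` S] `<=` range h.
Proof.
move=> cmlL; have [h [[_ hM hgen] _]] :=
  free_cml_universal (fun i : 'I_#|` S| => nth 1%g S i) cmlL.
exists h => //; apply: smallest_sub => [|x /= xS].
  apply: image_subloop => //; split=> //.
have iS : (index x S < #|` S|)%N by rewrite index_mem.
by exists (free_gen (Ordinal iS)); rewrite ?hgen//= nth_index.
Qed.

Theorem corollary7p3 (R : realType) :
  exists C : R, 0 < C /\
  forall (M : loopType) (K : R) (A : {fset M}) (H : set M) (d : nat),
    is_cml M -> exponent3 M ->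
    1 <= K -> approx_subloop K A ->
    H = gen_subloop [set` A] -> is_min_gen_size H d ->
    exists J : {fset M},
      [/\ is_subloop [set` J], [set` J] `<=` H,
          exists X : {fset M},
            [/\ [set` X] `<=` H,
                [set` A] `<=` \bigcup_(x in [set` X]) [set` lcoset_loop x J]
              & ((#|` X|%:R)%:E <= (2%:E * K%:E * beta R d) `^ C)%E]
        & ((#|` J|%:R)%:E <= beta R d * (#|` A|%:R)%:E)%E].
Proof.
(* With $b = \beta(d)$ finite, the cosets number at most $3^d \le 9b \le (2b)^4 \le (2Kb)^4$. *)
exists 4; split=> // M K A H d cmlM exp3 K1 [A1 _ _] HA [[S SH Sd] _].
have sH : is_subloop H by rewrite HA; apply: gen_subloop_is_subloop.
have A_gt0 : (0 < #|` A|)%N by rewrite cardfs_gt0; apply/fset0Pn; exists 1%g.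
have AH : [set` A] `<=` H by rewrite HA; apply: sub_gen_smallest.
have [fin|inf] := pselect (finite_set (assoc_subloop (free_cml d))); last first.
  have -> : beta R d = +oo%E by rewrite /beta /counting asboolF.
  (* Positivity matters, since $0 \cdot \infty = 0$ here; it comes from $K \ge 1$ and $1 \in A$.
     Then $J = \{1\}$ and $X = A$ work. *)
  have oo_mul (x : R) : 0 < x -> (x%:E * +oo)%E = +oo%E.
    by move=> x0; rewrite gt0_muley// lte_fin.
  have K0 : 0 < K by apply: lt_le_trans K1.
  exists [fset 1%g]%fset; split.
  - apply: mul_closed_subloop => //; first by rewrite /= inE.
    by move=> x y /=; rewrite !inE => /eqP-> /eqP->; rewrite mulg1.
  - by move=> x /=; rewrite inE => /eqP->; case: sH.
  - exists A; split=> // [x xA|].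
      exists x => //=; apply/imfsetP; exists 1%g; rewrite ?inE// mulg1//.
    by rewrite -EFinM oo_mul ?mulr_gt0// poweRyr ?gt_eqF// leey.
  - by rewrite muleC oo_mul ?leey// ltr0n.
pose F' := fset_set (assoc_subloop (free_cml d)).
have betaE : beta R d = (#|` F'|%:R)%:E by rewrite /beta /counting asboolT.
have [h hM SF] : exists2 h : free_cml d -> M,
    {morph h : x y / (x * y)%g} & H `<=` range h.
  by rewrite -SH -Sd; apply: gen_subloop_range_free.
pose D := derived_subloop H.
have DF : D `<=` h @` assoc_subloop (free_cml d).
  exact: derived_subloop_image.
have finD : finite_set D by apply: sub_finite_set DF _; apply: finite_image.
have SsubH : [set` S] `<=` H by rewrite -SH; apply: sub_gen_smallest.
have cardD : (#|` fset_set D| <= #|` F'|)%N.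
  have := leq_imfset_card imfset_key h (mem F'); apply: leq_trans.
  rewrite -fset_set_image//; apply: fsubset_leq_card.
  by rewrite -fset_set_sub//; apply: finite_image.
exists (fset_set D); split.
- by rewrite fset_setK//; apply: gen_subloop_is_subloop.
- by rewrite fset_setK//; apply: derived_subloop_sub.
- exists [fset x in coset_reps S]%fset; split.
  + by move=> x; rewrite /= inE => xin; apply: (coset_reps_sub sH SsubH).
  + move=> x /AH; rewrite -SH.
    move=> /(derived_subloop_cover cmlM exp3 sH SsubH) [w win [j Dj ->]].
    exists w; first by rewrite /= inE.
    by apply/imfsetP; exists j; rewrite //= in_fset_set// inE.
  + rewrite betaE -!EFinM poweR_EFin lee_fin powR_mulrn ?mulr_ge0//; last first.
      exact: le_trans K1.
    have cardX : (#|` [fset x in coset_reps S]%fset| <= 9 * #|` F'|)%N.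
      apply: leq_trans (exp3_leq_card_assoc_subloop_free fin).
      rewrite card_fseq; apply: leq_trans (size_undup _) _.
      by rewrite size_coset_reps -Sd.
    apply: (@le_trans _ _ ((2 * #|` F'|) ^ 4)%:R).
      rewrite ler_nat; apply: leq_trans cardX _.
      (* Factorwise, $9 \le 2^4$ and $b \le b^4$, with zero treated apart. *)
      rewrite expnMn leq_mul//; case: #|` F'| => // b.
      by rewrite -[leqLHS]expn1 leq_pexp2l.
    rewrite natrX natrM lerXn2r ?nnegrE ?mulr_ge0// ?(le_trans _ K1)//.
    by rewrite ler_wpM2r// ler_peMr.
- by rewrite betaE -EFinM lee_fin -natrM ler_nat; apply: leq_trans cardD _;
    rewrite leq_pmulr.
Qed.
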